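(* Consider a network with $T$-periodic external inflows $\lambda(t)$ and $T$-periodic capacity functions $c(t)$, nonnegative, piecewise constant over a period, and satisfying the stability condition. Then the queue lengths $x^{(k)}$ and link outflows $z^{(k)}$ computed by the iterative network algorithm (described in the context) satisfy, for all $k\ge1$, $$z^{(k+1)}(t)\ge z^{(k)}(t)\quad\text{and}\quad x^{(k+1)}(t)\ge x^{(k)}(t)\qquad\text{for all }t\in[0,T]$$ (componentwise inequalities).
   Context: Road network: a finite directed multigraph $\mathcal G=(\mathcal V,\mathcal E)$ without self-loops; $\mathcal E$ is the set of links. $R\in\mathbb{R}_{\ge0}^{\mathcal E\times\mathcal E}$ is the routing matrix: $R_{ji}$ is the fraction of the flow leaving link $j$ that goes to link $i$, with $R_{ji}=0$ if $i$ is not immediately downstream of $j$. $R$ is sub-stochastic: nonnegative entries, all row sums at most $1$, at least one row sum strictly less than $1$. Standing connectivity assumption: (i) for every $i,j\in\mathcal E$ there is a directed path from $i$ to $j$ or from $j$ to $i$; (ii) for every $i\in\mathcal E$, either the $i$-th row sum of $R$ is strictly less than $1$, or there is a directed path (along links with consecutive positive entries of $R$) from $i$ to some link $j$ whose row sum in $R$ is strictly less than $1$. In particular the spectral radius of $R$ is strictly less than $1$. $\delta_{ji}\ge0$ is the travel time from link $j$ to link $i$. Piecewise constant: finitely many contiguous right-open pieces over a period. Stability condition: there exists $\epsilon>0$ with $[I-R^T]\bar c>\bar\lambda+\epsilon\mathbf 1$ entrywise, where $\bar\lambda_i=\frac1T\int_0^T\lambda_i$, $\bar c_i=\frac1T\int_0^Tc_i$.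 Single-link procedure. Given a link with $T$-periodic, piecewise constant inflow $y\ge0$ and capacity $c\ge0$ with $\int_0^Ty<\int_0^Tc$, functions $\mathcal F_x(y,c)=x$ and $\mathcal F_z(y,c)=z$ are computed as follows. If $\{t\in[0,T):y(t)>c(t)\}$ has measure zero, $x\equiv0$. Otherwise let $W^1,\dots,W^{M^w}$ (resp. $B^1,\dots,B^{M^b}$) be the maximal intervals of nonzero length in $[0,T)$, in increasing order, on which $y>c$ (resp. $y<c$), with closures $[\underline w^k,\bar w^k]$ (resp. $[\underline b^k,\bar b^k]$). Put $Y(s_1,s_2)=\int_{s_1}^{s_2}y$, $C(s_1,s_2)=\int_{s_1}^{s_2}c$. Set $r_1=1$ and, for $j\ge2$, let $r_j$ be the smallest $n\in\{r_{j-1}+1,\dots,M^w\}$ for which there is $p\in\{1,\dots,M^b\}$ with $\bar b^p\in(\underline w^{n-1},\underline w^n]$ and: $Y(\underline w^{r_{j-1}},\bar b^p)\le C(\underline w^{r_{j-1}},\bar b^p)$ if $\bar b^p<\underline w^n$, or $Y(\underline w^{r_{j-1}},\bar b^p)<C(\underline w^{r_{j-1}},\bar b^p)$ if $\bar b^p=\underline w^n$; stop when no such $n$ exists, and let $r_m$ be the last index obtained. Put $\alpha^L=\underline w^{r_m}$ and $x(0)=\max\{Y(\alpha^L,T)-C(\alpha^L,T),0\}$, and let $x$ on $[0,T]$ be the solution from $x(0)$ of the isolated-link dynamics $\dot x=y-z$, where $z(t)=c(t)$ if $x(t)>0$ and $z(t)=\min\{c(t),y(t)\}$ if $x(t)=0$.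 In all cases $z$ is given by this same formula, and $x,z$ are extended $T$-periodically. (The function $x$ so obtained is the unique $T$-periodic solution of the isolated-link dynamics.) Network algorithm. Set $y_i^{(1)}(t)=\lambda_i(t)$ for all $i\in\mathcal E$. For $k=1,2,\dots$, and all $i\in\mathcal E$: $x_i^{(k)}=\mathcal F_x(y_i^{(k)},c_i)$, $z_i^{(k)}=\mathcal F_z(y_i^{(k)},c_i)$, and $y_i^{(k+1)}(t)=\lambda_i(t)+\sum_{j\in\mathcal E}R_{ji}z_j^{(k)}(t-\delta_{ji})$. *)

(* Defs.v *)
From HB Require Import structures.
From mathcomp Require Import all_boot all_order all_algebra.
From mathcomp Require Import all_classical all_reals all_analysis.
Set Implicit Arguments.
Unset Strict Implicit.
Unset Printing Implicit Defensive.
Import Order.TTheory GRing.Theory Num.Theory.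
Import numFieldNormedType.Exports.
Local Open Scope classical_set_scope.
Local Open Scope ring_scope.

Section Signals.
Context {R : realType}.
Implicit Types (T : R) (f : R -> R).

Definition piecewise_constant T f : Prop :=
  exists s v : seq R, itv_partition 0 T s /\
    forall n t, (n < size s)%N ->
      nth 0 (0 :: s) n <= t < nth 0 (0 :: s) n.+1 -> f t = nth 0 v n.

Definition signal T f : Prop :=
  [/\ periodic f T, forall t, 0 <= f t & piecewise_constant T f].

Definition integral_on f (a b : R) : R :=
  (\int[lebesgue_measure]_(t in `[a, b]) f t)%R.

Definition mean T f : R := T^-1 * integral_on f 0 T.

(* Only the values of f on [0, T[ matter. *)
Definition periodic_extension T f : R -> R :=
  fun t => f (t - (Num.floor (t / T))%:~R * T).

End Signals.

Section SingleLink.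
Context {R : realType}.
Implicit Types (T : R) (x y c : R -> R) (S I J : set R) (W B : seq (set R)).

Definition link_outflow x y c : R -> R :=
  fun t => if 0 < x t then c t else Num.min (c t) (y t).

(* Queue lengths are nonnegative.  As y and c are discontinuous at finitely
   many instants and z switches when the queue empties, the equation
   x' = y - z cannot be required everywhere: x is continuous and satisfies it
   off a finite set of instants. *)
Definition isolated_link_solution T y c (x0 : R) : set (R -> R) :=
  [set x | [/\ x 0 = x0,
      forall t, 0 <= t <= T -> 0 <= x t,
      {within `[0, T], continuous x}
    & exists2 A : set R, finite_set A &
        forall t, 0 < t < T -> ~ A t ->
          is_derive t (1 : R) x (y t - link_outflow x y c t)]].

Definition maximal_interval S I : Prop :=
  [/\ is_interval I, exists a b, [/\ a < b, I a & I b], I `<=` S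
    & forall J, is_interval J -> I `<=` J -> J `<=` S -> J = I].

Definition lists_maximal_intervals S W : Prop :=
  sorted (fun I J : set R => inf I < inf J) W /\
  forall I, (I \in W) <-> maximal_interval S I.

(* A strictly increasing list with prescribed elements is unique; the default
   [::] is only reached if S has infinitely many maximal intervals. *)
Definition maximal_intervals S : seq (set R) :=
  xget [::] [set W | lists_maximal_intervals S W].

(* The closure of an interval I is [inf I, sup I].  The indices of W start
   at 0, so index n stands for W^(n+1). *)
Definition lower_end W (n : nat) : R := inf (nth set0 W n).

Definition admissible_index y c W B (r n : nat) : bool :=
  has (fun I : set R =>
         let b := sup I in
         let Y := integral_on y (lower_end W r) b in
         let C := integral_on c (lower_end W r) b in
         [&& lower_end W n.-1 < b, b <= lower_end W n
           & if b < lower_end W n then Y <= C else Y < C]) B.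

Definition next_index y c W B (r : nat) : option nat :=
  ohead [seq n <- iota r.+1 (size W - r.+1) | admissible_index y c W B r n].

(* The index strictly increases, and remains below size W, as long as
   next_index succeeds, so size W iterations always reach the index at which
   the search stops. *)
Definition last_index y c W B : nat :=
  iter (size W) (fun r => odflt r (next_index y c W B r)) 0%N.

Definition initial_queue T y c : R :=
  let W := maximal_intervals [set t | 0 <= t < T /\ c t < y t] in
  let B := maximal_intervals [set t | 0 <= t < T /\ y t < c t] in
  let alpha := lower_end W (last_index y c W B) in
  Num.max (integral_on y alpha T - integral_on c alpha T) 0.

Definition queue_on_period T y c : R -> R :=
  if lebesgue_measure [set t : R | 0 <= t < T /\ c t < y t] == 0%E then cst 0
  else xget (cst 0) (isolated_link_solution T y c (initial_queue T y c)).

Definition Fx T y c : R -> R := periodic_extension T (queue_on_period T y c).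

Definition Fz T y c : R -> R :=
  periodic_extension T (link_outflow (queue_on_period T y c) y c).

End SingleLink.

Section Network.
Context {R : realType} {V E : finType}.
Implicit Types (tail head : E -> V) (Rt delta : E -> E -> R).
Implicit Types (lam c : E -> R -> R).

Definition row_sum Rt (j : E) : R := \sum_(i : E) Rt j i.

Definition substochastic Rt : Prop :=
  [/\ forall j i, 0 <= Rt j i, forall j, row_sum Rt j <= 1
    & exists j, row_sum Rt j < 1].

(* Link e goes from vertex tail e to vertex head e. *)
Definition downstream tail head : rel E := fun j i => head j == tail i.

Definition routing_matrix tail head Rt : Prop :=
  substochastic Rt /\ forall j i, ~~ downstream tail head j i -> Rt j i = 0.

Definition connectivity tail head Rt : Prop :=
  (forall i j, connect (downstream tail head) i j \/
               connect (downstream tail head) j i) /\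
  (forall i, row_sum Rt i < 1 \/
     exists2 j, connect (fun k l => 0 < Rt k l) i j & row_sum Rt j < 1).

Definition stability T Rt lam c : Prop :=
  exists2 eps : R, 0 < eps &
    forall i, mean T (lam i) + eps <
              mean T (c i) - \sum_(j : E) Rt j i * mean T (c j).

Definition next_inflow T Rt delta lam c (y : E -> R -> R) : E -> R -> R :=
  fun i t => lam i t + \sum_(j : E) Rt j i * Fz T (y j) (c j) (t - delta j i).

(* Iterations are numbered from k = 1; the value at k = 0 is irrelevant. *)
Definition inflow T Rt delta lam c (k : nat) : E -> R -> R :=
  iter k.-1 (next_inflow T Rt delta lam c) lam.

Definition queue T Rt delta lam c (k : nat) (i : E) : R -> R :=
  Fx T (inflow T Rt delta lam c k i) (c i).

Definition outflow T Rt delta lam c (k : nat) (i : E) : R -> R :=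
  Fz T (inflow T Rt delta lam c k i) (c i).

End Network.

(* Main.v *)
Require Import Defs.
From mathcomp Require Import all_boot all_order all_algebra.
From mathcomp Require Import all_classical all_reals all_analysis.
From mathcomp Require Import ring lra zify.
Set Implicit Arguments.
Unset Strict Implicit.
Unset Printing Implicit Defensive.
Import Order.TTheory GRing.Theory Num.Theory.
Import numFieldNormedType.Exports.
Local Open Scope classical_set_scope.
Local Open Scope ring_scope.

(** The iteration is monotone because one link is: if [y <= y'], then the
    queue and the outflow that the single-link procedure computes from [y] are
    below those that it computes from [y'] ([Fx_le], [Fz_le]).  Since
    [y^(2) - y^(1)] is a nonnegative combination of outflows and the map from
    [y^(k)] to [y^(k+1)] is monotone, the inflows increase with [k], and with
    them the queues and outflows.

    Monotonicity of one link has two ingredients.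

    - The initial queue.  The search through the intervals where [y > c] is a
      greedy search for the instant [s] that maximizes [D s], the integral of
      [y - c] from [s] to [T]: on a stretch without excess ([y <= c]) [D]
      increases, on a stretch of excess it decreases, so the maximum over
      [0, T] is reached at the start of an interval of excess or is
      [D T = 0].  Hence the initial queue is the maximum of [D] over [0, T]
      ([initial_queue_max]), a quantity that visibly increases with [y]
      ([initial_queue_le]).

    - The dynamics.  Let [x1], [x2] be solutions for inflows [y1 <= y2] with
      [x1 <= x2] at the start.  While [x1 > x2 >= 0], the first queue is busy
      and empties at the full rate [c], so [x1 - x2] cannot increase; hence
      [x1] never overtakes [x2] ([solution_le]).  This also gives uniqueness.
      A solution exists because on a piece where [y] and [c] are constant the
      queue is affine until it empties and then stays empty, and these pieces
      can be glued ([solvable_step]); the same gluing shows that the outflow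
      is again piecewise constant, so that the next inflow can be processed.

    Piecewise constancy is used in the form [step a b D f]: [f] takes the same
    value at two points of [a, b) unless a point of the finite list [D]
    separates them.  As [D] is neither sorted nor confined to [a, b), common
    refinements are concatenations of lists. *)

(** * Step functions *)

Section StepFunctions.
Context {R : realType}.
Implicit Types (a b d t u T : R) (D : seq R).

(** A break at [d] separates [t] from [u] when [t < d <= u]: the pieces are
    closed on the left and open on the right. *)
Definition step (U : Type) a b D (f : R -> U) : Prop :=
  forall t u, a <= t -> t <= u -> u < b ->
    (forall d, d \in D -> ~~ (t < d <= u)) -> f t = f u.

Definition is_step (U : Type) a b (f : R -> U) := exists D, step a b D f.

Lemma step_itv (U : Type) a b a' b' D (f : R -> U) :
  a <= a' -> b' <= b -> step a b D f -> step a' b' D f.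
Proof.
move=> aa' bb' sf t u at_ tu ub; apply: sf => //.
- exact: le_trans at_.
- exact: lt_le_trans bb'.
Qed.

Lemma step_cons_outside (U : Type) a b d D (f : R -> U) :
  d <= a \/ b <= d -> step a b (d :: D) f -> step a b D f.
Proof.
move=> out sf t u at_ tu ub H; apply: sf => // e.
rewrite inE => /predU1P[->|/H//].
by apply/negP => /andP[td du]; case: out => ?; lra.
Qed.

Lemma is_step_pair (U V : Type) a b (f : R -> U) (g : R -> V) :
  is_step a b f -> is_step a b g -> is_step a b (fun t => (f t, g t)).
Proof.
move=> [D1 s1] [D2 s2]; exists (D1 ++ D2) => t u at_ tu ub H.
by congr pair; [apply: s1|apply: s2] => // d dD; apply: H;
  rewrite mem_cat dD ?orbT.
Qed.

Lemma is_step_comp (U V : Type) (g : U -> V) a b (f : R -> U) :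
  is_step a b f -> is_step a b (fun t => g (f t)).
Proof.
by move=> [D sf]; exists D => t u ? ? ? H; congr g; apply: sf.
Qed.

Lemma is_step_cst (U : Type) a b (k : U) : is_step a b (fun=> k).
Proof. by exists [::]. Qed.

Lemma is_step_eq (U : Type) a b (f g : R -> U) :
  (forall t, a <= t < b -> f t = g t) -> is_step a b f -> is_step a b g.
Proof.
move=> fg [D sf]; exists D => t u at_ tu ub H.
by rewrite -!fg; [exact: sf|apply/andP; split; lra..].
Qed.

Lemma is_step_sum (I : finType) a b (f : I -> R -> R) :
  (forall i, is_step a b (f i)) -> is_step a b (fun t => \sum_i f i t).
Proof.
move=> sf; elim: (index_enum I) => [|i s IH].
  by apply: is_step_eq (is_step_cst a b 0) => t _; rewrite big_nil.
have := is_step_comp (fun p : R * R => p.1 + p.2) (is_step_pair (sf i) IH).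
by apply: is_step_eq => t _; rewrite big_cons.
Qed.

(** Induction over the pieces of a step function: an interval containing a
    break is cut there, and without break the function is constant.  The codomain
    is arbitrary so that two functions can be treated at once, as a pair. *)
Lemma step_ind (U : Type) (f : R -> U) (P : R -> R -> Prop) :
  (forall a b, a < b -> (forall t, a <= t < b -> f t = f a) -> P a b) ->
  (forall a d b, a < d -> d < b -> P a d -> P d b -> P a b) ->
  forall a b, a < b -> is_step a b f -> P a b.
Proof.
move=> Pcst Pcat a b + [D]; elim: D a b => [|d D IH] a b ab sf.
  by apply: Pcst => // t /andP[at_ tb]; rewrite (sf a t).
have [/andP[ad db]|out] := boolP (a < d < b).
  apply: (Pcat _ d) => //; apply: IH => //.
    by apply: (@step_cons_outside _ _ _ d); [right|apply: step_itv sf => //; lra].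
  by apply: (@step_cons_outside _ _ _ d); [left|apply: step_itv sf => //; lra].
apply: IH => //; apply: step_cons_outside sf.
by move: out; rewrite negb_and -!leNgt => /orP.
Qed.

(** [e] is the first break after [t], or [T]: every piece is nondegenerate. *)
Lemma exists_next D t T : t < T ->
  exists2 e, t < e <= T & forall d, d \in D -> ~~ (t < d < e).
Proof.
move=> tT; elim: D => [|d D [e /andP[te eT] H]].
  by exists T => //; rewrite tT lexx.
have [/andP[td de]|out] := boolP (t < d < e).
  exists d; first by rewrite td /=; lra.
  move=> f; rewrite inE => /predU1P[->|/H /negP out]; first by rewrite ltxx andbF.
  by apply/negP => /andP[tf fd]; apply: out; rewrite tf /=; lra.
by exists e; rewrite ?te // => f; rewrite inE => /predU1P[->|/H].
Qed.

(** The left end of the piece of [t].  It belongs to a finite list, which is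
    why a set described by a step function has finitely many components. *)
Lemma exists_prev D a t : a <= t ->
  exists2 d, d \in a :: D & a <= d <= t /\
    forall d', d' \in D -> ~~ (d < d' <= t).
Proof.
move=> at_; elim: D => [|d D [e eD [/andP[ae et] H]]].
  by exists a; rewrite ?inE // lexx.
have [/andP[ed dt]|out] := boolP (e < d <= t).
  exists d; first by rewrite !inE eqxx orbT.
  split; first by rewrite dt andbT; lra.
  move=> f; rewrite inE => /predU1P[->|/H /negP out]; first by rewrite ltxx.
  by apply/negP => /andP[tf fd]; apply: out; rewrite fd andbT; lra.
exists e; first by move: eD; rewrite !inE => /orP[]->; rewrite ?orbT.
by rewrite ae; split => // f; rewrite inE => /predU1P[->|/H].
Qed.

Lemma path_itv_mem (x0 a t : R) (s : seq R) :
  a <= t < last a s ->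
  exists2 n, (n < size s)%N & nth x0 (a :: s) n <= t < nth x0 (a :: s) n.+1.
Proof.
elim: s a => [|e s IH] a /=; first by move=> /andP[? ?]; lra.
move=> /andP[at_ tl]; have [te|et] := ltP t e.
  by exists 0%N => //=; rewrite at_.
have [|n ns H] := IH e; first by rewrite et.
by exists n.+1.
Qed.

Lemma piecewise_constant_step T (f : R -> R) :
  piecewise_constant T f -> is_step 0 T f.
Proof.
move=> [s [v [[ps /eqP ls] H]]]; exists s => t u t0 tu uT no.
have [|n ns /andP[nt tn]] := @path_itv_mem 0 0 t s; first by rewrite ls; lra.
rewrite (H n) ?nt ?tn // (H n) // (le_trans nt tu) /= ltNge; apply/negP => nu.
by move: (no _ (mem_nth 0 ns)); rewrite tn nu.
Qed.

End StepFunctions.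

(** * Integrals of step functions *)

Section StepIntegrals.
Context {R : realType}.
Notation mu := (@lebesgue_measure R).
Implicit Types (a b d t u T : R) (f g y c : R -> R).

Lemma step_measurable_bounded a b f : a < b -> is_step a b f ->
  measurable_fun `[a, b[ f /\ exists M, forall t, a <= t < b -> `|f t| <= M.
Proof.
apply: (step_ind (P := fun a b => measurable_fun `[a, b[ f /\
  exists M, forall t, a <= t < b -> `|f t| <= M)) => {a b}.
  move=> a b ab fE; split.
    apply: (eq_measurable_fun (cst (f a))) => [t|]; last exact: measurable_cst.
    by rewrite inE /= in_itv /= => /fE ->.
  by exists `|f a| => t /fE ->.
move=> a d b ad db [m1 [M1 B1]] [m2 [M2 B2]]; split.
  rewrite (@itv_bndbnd_setU _ _ _ (BLeft d)) ?bnd_simp ?ltW //.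
  by apply/measurable_funU.
exists (Num.max M1 M2) => t /andP[at_ tb]; rewrite le_max.
by have [td|dt] := ltP t d; [rewrite B1 ?at_|rewrite B2 ?dt ?orbT].
Qed.

Lemma step_integrable a b f : is_step a b f -> mu.-integrable `[a, b] (EFin \o f).
Proof.
have [ba _|ab] := leP b a.
  have -> : `[a, b]%classic = (if a == b then [set a] else set0).
    apply/seteqP; split=> t /=; rewrite in_itv /=.
      by move=> /andP[at_ tb]; have -> : a = b by [lra]; rewrite eqxx /=; lra.
    by case: eqP => [->|//] /= ->; rewrite lexx.
  case: ifP => _; last exact: integrable_set0.
  by apply/integrableP; split; [exact: measurable_fun_set1|rewrite integral_set1].
move=> /(step_measurable_bounded ab)[mf [M BM]].
apply: measurable_bounded_integrable => //=.
- by rewrite lebesgue_measure_itv /=; case: ifP => _; rewrite -?EFinB ltry.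
- exact/measurable_realfun.measurable_fun_itv_bndo_bndcP.
exists (Num.max M `|f b|); split; first exact: num_real.
move=> x Mx t /=; rewrite in_itv /= => /andP[at_].
rewrite le_eqVlt => /predU1P[->|tb]; apply: le_trans (ltW Mx).
  by rewrite le_max lexx orbT.
by rewrite le_max BM ?at_.
Qed.

Lemma sub_integrable T a b f : is_step 0 T f -> 0 <= a -> b <= T ->
  mu.-integrable `[a, b] (EFin \o f).
Proof.
by move=> [D sf] a0 bT; apply: step_integrable; exists D; apply: step_itv sf.
Qed.

Lemma integral_on_cat T a b d f : is_step 0 T f ->
  0 <= a -> a <= b -> b <= d -> d <= T ->
  integral_on f a d = integral_on f a b + integral_on f b d.
Proof.
move=> sf a0 ab bd dT; rewrite /integral_on.
have fi := sub_integrable sf a0 dT.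
have := @Rintegral_itvB _ f (BLeft a) (BRight d) b fi.
rewrite !bnd_simp => /(_ ab bd) H.
rewrite -(@Rintegral_itv_obnd_cbnd _ b (BRight d)); last first.
  by apply: integrableS fi => //; apply: subset_itvr; rewrite bnd_simp.
by rewrite -H addrC subrK.
Qed.

Lemma le_integral_on T a b f g : is_step 0 T f -> is_step 0 T g ->
  0 <= a -> b <= T -> (forall t, a < t < b -> f t <= g t) ->
  integral_on f a b <= integral_on g a b.
Proof.
move=> sf sg a0 bT fg; rewrite /integral_on.
have fi := sub_integrable sf a0 bT; have gi := sub_integrable sg a0 bT.
have oo h : mu.-integrable `[a, b] (EFin \o h) ->
    mu.-integrable `]a, b[ (EFin \o h) /\
    (\int[mu]_(t in `[a, b]) h t)%R = (\int[mu]_(t in `]a, b[) h t)%R.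
  move=> hi.
  have hi1 : mu.-integrable `[a, b[ (EFin \o h).
    by apply: integrableS hi => //; apply: subset_itvl; rewrite bnd_simp.
  have hi2 : mu.-integrable `]a, b[ (EFin \o h).
    by apply: integrableS hi1 => //; apply: subset_itvr; rewrite bnd_simp.
  by split=> //; rewrite -Rintegral_itv_bndo_bndc // -Rintegral_itv_obnd_cbnd.
have [fi' ->] := oo _ fi; have [gi' ->] := oo _ gi.
by apply: le_Rintegral => // t /=; rewrite in_itv /= => /fg.
Qed.

Definition net_inflow y c a b : R := integral_on y a b - integral_on c a b.

Lemma net_inflow_cat T a b d y c : is_step 0 T y -> is_step 0 T c ->
  0 <= a -> a <= b -> b <= d -> d <= T ->
  net_inflow y c a d = net_inflow y c a b + net_inflow y c b d.
Proof.
move=> sy sc a0 ab bd dT; rewrite /net_inflow.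
rewrite (integral_on_cat sy a0 ab bd dT) (integral_on_cat sc a0 ab bd dT); lra.
Qed.

Lemma net_inflow_le0 T a b y c : is_step 0 T y -> is_step 0 T c ->
  0 <= a -> b <= T -> (forall t, a < t < b -> y t <= c t) ->
  net_inflow y c a b <= 0.
Proof. by move=> *; rewrite subr_le0; apply: (@le_integral_on T). Qed.

Lemma net_inflow_ge0 T a b y c : is_step 0 T y -> is_step 0 T c ->
  0 <= a -> b <= T -> (forall t, a < t < b -> c t <= y t) ->
  0 <= net_inflow y c a b.
Proof. by move=> *; rewrite subr_ge0; apply: (@le_integral_on T). Qed.

End StepIntegrals.

(** * Maximal intervals *)

Section IntervalEnds.
Context {R : realType}.
Implicit Types (I : set R) (t u p q : R).

Lemma interval_gt_inf I q p : is_interval I -> inf I < q -> q <= p -> I p -> I q.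
Proof.
move=> iI /inf_lt -/(_ (ex_intro _ p _)) H qp Ip.
by have [x Ix xq] := H Ip; apply: (iI x p) => //; rewrite qp ltW.
Qed.

End IntervalEnds.

Section Components.
Context {R : realType}.
Implicit Types (S I J : set R) (t u : R).

(** The order-connected component of [t] in [S]; when [t] is outside [S] it is
    empty, as [v = t] is always among the instants tested. *)
Definition component S t : set R :=
  [set u | forall v, t <= v <= u \/ u <= v <= t -> S v].

Lemma component_refl S t : S t -> component S t t.
Proof. by move=> St v H; have -> : v = t by [case: H; lra]. Qed.

Lemma component_sub S t : component S t `<=` S.
Proof. by move=> u; apply; have [?|?] := leP t u; [left|right]; lra. Qed.

Lemma component_itv S t : is_interval (component S t).
Proof.
move=> x z Cx Cz y /andP[xy yz] v [H|H].
  by apply: Cz; left; lra.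
by apply: Cx; right; lra.
Qed.

Lemma sub_component S t I : is_interval I -> I `<=` S -> I t -> I `<=` component S t.
Proof.
move=> iI IS It u Iu v H; apply: IS.
by case: H => H; [apply: (iI t u)|apply: (iI u t)].
Qed.

Lemma component_eq S t u : component S t u -> component S u = component S t.
Proof.
move=> Cu; have St : S t.
  by apply: Cu; have [?|?] := leP t u; [left|right]; lra.
have tu : component S t `<=` component S u.
  exact: sub_component (@component_itv _ _) (@component_sub _ _) Cu.
apply/seteqP; split=> //.
have ut : component S u t by apply/tu; exact: component_refl.
exact: sub_component (@component_itv _ _) (@component_sub _ _) ut.
Qed.

Lemma maximal_component S I t : maximal_interval S I -> I t -> I = component S t.
Proof.
move=> [iI _ IS mI] It; apply/esym/mI; [exact: component_itv| |exact: component_sub].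
exact: sub_component.
Qed.

Lemma component_maximal S t e : t < e -> (forall u, t <= u < e -> S u) ->
  maximal_interval S (component S t).
Proof.
move=> te He; have St : S t by apply: He; lra.
split; [exact: component_itv| |exact: component_sub|].
  exists t, ((t + e) / 2); split; [lra|exact: component_refl|].
  by move=> v H; apply: He; case: H; lra.
move=> J iJ CJ JS; apply/seteqP; split=> //.
by apply: sub_component => //; apply/CJ; exact: component_refl.
Qed.

Lemma inf_le_maximal S I t : has_lbound S -> maximal_interval S I -> I t ->
  inf I <= t.
Proof.
move=> [l lS] [_ _ IS _] It; apply: ge_inf => //.
by exists l => u /IS /lS.
Qed.

Lemma le_sup_maximal S I t : has_ubound S -> maximal_interval S I -> I t ->
  t <= sup I.
Proof.
move=> [l lS] [_ _ IS _] It; apply: ub_le_sup => //.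
by exists l => u /IS /lS.
Qed.

Lemma maximal_interval_inf_lt S I : has_lbound S -> maximal_interval S I ->
  exists2 e, inf I < e & forall t, inf I < t <= e -> I t.
Proof.
move=> lS mI; have [iI [a [b [ab Ia Ib]]] _ _] := mI.
have Ia' := inf_le_maximal lS mI Ia.
exists b; first lra.
by move=> t /andP[It tb]; apply: interval_gt_inf It tb Ib.
Qed.

(** Two maximal intervals that start at the same point overlap just after it,
    because neither is reduced to a point. *)
Lemma maximal_interval_inf_inj S I J : has_lbound S -> maximal_interval S I ->
  maximal_interval S J -> inf I = inf J -> I = J.
Proof.
move=> lS mI mJ IJ.
have [e ie He] := maximal_interval_inf_lt lS mI.
have [f jf Hf] := maximal_interval_inf_lt lS mJ.
have [m Im Jm] : exists2 m, I m & J m.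
  by exists (Num.min e f); [apply: He|apply: Hf];
    rewrite ?ge_min ?lexx ?orbT andbT lt_min; lra.
by rewrite (maximal_component mI Im) (maximal_component mJ Jm).
Qed.

(** The components of [S] are those of the left ends of the pieces on which [g]
    holds, hence finitely many, and sorting them by their infimum gives the list
    that [maximal_intervals] selects.  Right-open pieces have positive length,
    so no point of [S] escapes the list. *)
Lemma maximal_intervalsP T (g : R -> bool) : is_step 0 T g ->
  let S := [set t | 0 <= t < T /\ g t] in
  lists_maximal_intervals S (maximal_intervals S) /\
  forall t, S t -> exists2 I, I \in maximal_intervals S & I t.
Proof.
move=> [D sg] S; have lS : has_lbound S by exists 0 => t [/andP[]].
have mS t : S t -> maximal_interval S (component S t).
  move=> [/andP[t0 tT] gt]; have [e /andP[te eT] He] := exists_next D tT.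
  apply: (component_maximal te) => u /andP[tu ue]; split; first lra.
  rewrite -(sg t u) //; first lra.
  move=> d /He /negP h; apply/negP => /andP[td du]; apply: h; rewrite td /=; lra.
pose L := undup [seq component S d | d <- [seq d <- 0 :: D | `[< S d >]]].
have memL I : (I \in L) <-> maximal_interval S I.
  rewrite mem_undup; split.
    by move=> /mapP[d]; rewrite mem_filter => /andP[/asboolP Sd _] ->; exact: mS.
  move=> mI; have [iI [t [_ [_ It _]]] IS _] := mI.
  have [/andP[t0 tT] gt] := IS _ It.
  have [d dD [/andP[d0 dt] Hd]] := exists_prev D t0.
  have dtS u : d <= u <= t -> S u.
    move=> /andP[du ut]; split; first lra.
    rewrite (sg u t) //; [lra..|].
    move=> e /Hd /negP h; apply/negP => /andP[ue et]; apply: h; rewrite et andbT; lra.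
  have Sd : S d by apply: dtS; rewrite lexx.
  apply/mapP; exists d; first by rewrite mem_filter dD andbT; exact/asboolP.
  rewrite (maximal_component mI It); apply: component_eq => u.
  by case=> ?; [exact: dtS|have -> : u = d by [lra]].
have ex : exists W, lists_maximal_intervals S W.
  exists (sort (fun I J : set R => inf I <= inf J) L); split; last first.
    by move=> I; rewrite mem_sort; exact: memL.
  have tot : total (fun I J : set R => inf I <= inf J) by move=> I J; exact: le_total.
  rewrite -(@sorted_map _ _ (fun I : set R => inf I) <%O) lt_sorted_uniq_le sorted_map.
  rewrite sort_sorted // andbT map_inj_in_uniq ?sort_uniq ?undup_uniq //.
  move=> I J; rewrite !mem_sort => /memL mI /memL mJ.
  exact: maximal_interval_inf_inj mI mJ.
have Wl : lists_maximal_intervals S (maximal_intervals S) by apply: xgetPex.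
split=> // t St; exists (component S t); last exact: component_refl.
by apply/Wl.2/mS.
Qed.

End Components.

(** * The initial queue *)

Section Search.
Local Open Scope nat_scope.

Lemma ohead_filter_iotaP (p : pred nat) a k :
  match ohead [seq n <- iota a k | p n] with
  | Some n => [/\ a <= n < a + k, p n & forall j, a <= j < n -> ~~ p j]
  | None => forall j, a <= j < a + k -> ~~ p j
  end.
Proof.
elim: k a => [|k IH] a /=; first by move=> j; lia.
case pa : (p a) => /=; first by split=> //; [lia|move=> j; lia].
have := IH a.+1; case: ohead => [n [an pn Hn]|H].
  split=> //; first lia.
  move=> j ajn; have [->|ja] := eqVneq j a; first by rewrite pa.
  by apply: Hn; lia.
move=> j ajn; have [->|ja] := eqVneq j a; first by rewrite pa.
by apply: H; lia.
Qed.

Lemma exists_argmax (K : eqType) d (L : orderType d) (f : K -> L) (s : seq K) :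
  s != [::] -> exists2 x, x \in s & forall y, y \in s -> (f y <= f x)%O.
Proof.
elim: s => // x [|z s] IH _.
  by exists x; rewrite ?inE // => y; rewrite inE => /eqP ->.
have [//|m ms Hm] := IH.
have [xm|mx] := leP (f x) (f m).
  exists m; first by rewrite inE ms orbT.
  by move=> y; rewrite inE => /predU1P[->//|/Hm].
exists x; first by rewrite inE eqxx.
move=> y; rewrite inE => /predU1P[->//|/Hm ym]; exact: le_trans ym (ltW mx).
Qed.

(** The search in the abstract: [f] is to be maximized over the indices below
    [N].  A jump from [r] to [n] never decreases [f]; conversely the first
    index after [r] at which [f] exceeds [f r] is admissible, its predecessor
    having a value at most [f r].  So a skipped index never beats the current
    one, and the index at which the search stops is a maximizer. *)
Lemma greedy_max d (L : orderType d) (f : nat -> L) (adm : nat -> nat -> bool)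
    (N : nat) (next := fun r => ohead [seq n <- iota r.+1 (N - r.+1) | adm r n]) :
  0 < N ->
  (forall r n, r < n < N -> adm r n -> (f r <= f n)%O) ->
  (forall r n, r < n < N -> (f r < f n)%O -> (f n.-1 <= f r)%O -> adm r n) ->
  let m := iter N (fun r => odflt r (next r)) 0 in
  m < N /\ forall n, n < N -> (f n <= f m)%O.
Proof.
move=> N0 adm_le le_adm m.
have skip r n : r < n <= N -> (forall k, r < k < n -> ~~ adm r k) ->
    forall k, r <= k < n -> (f k <= f r)%O.
  move=> rn Hn; elim=> [|k IH] rk.
    by have -> : r = 0 by lia.
  have [->//|rk'] := eqVneq r k.+1.
  rewrite leNgt; apply/negP => lt; have /negP := Hn k.+1 ltac:(lia); apply.
  by apply: le_adm => //; [lia|apply: IH; lia].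
pose good r := r < N /\ forall k, k <= r -> (f k <= f r)%O.
have nextP r : good r -> match next r with
    | Some n => r < n /\ good n
    | None => forall k, k < N -> (f k <= f r)%O end.
  move=> [rN Hr]; have := ohead_filter_iotaP (adm r) r.+1 (N - r.+1).
  rewrite -/(next r); case: (next r) => [n [rn an Hn]|H] /=.
    split; first lia.
    split; first lia.
    have rn' : (f r <= f n)%O by apply: adm_le => //; lia.
    move=> k kn; have [->//|kn'] := eqVneq k n.
    apply: le_trans rn'; have [kr|rk] := leqP k r; first exact: Hr.
    by apply: (@skip r n) => //; lia.
  move=> k kN; have [kr|rk] := leqP k r; first exact: Hr.
  by apply: (@skip r N); [lia|move=> j jN; apply: H; lia|lia].
(* Each step increases the index or the search is over, so [N] steps suffice. *)
have iterP j : let r := iter j (fun r => odflt r (next r)) 0 in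
    good r /\ (j <= r \/ forall k, k < N -> (f k <= f r)%O).
  elim: j => [|j [gr IH]] /=.
    by split; [split=> // k; rewrite leqn0 => /eqP ->|left].
  set r := iter j _ _ in gr IH *.
  have := nextP _ gr; case: (next r) => [n [rn gn]|H] /=; last by split=> //; right.
  split=> //; case: IH => [jr|H]; first by left; lia.
  by right=> k kN; apply: le_trans (H k kN) _; case: gn => _; apply; lia.
have [[mN Hm] [Nm|H]] := iterP N; first by move: mN; rewrite ltnNge Nm.
by split.
Qed.

End Search.

Section InitialQueue.
Context {R : realType}.
Variables (T : R) (y c : R -> R).
Hypotheses (T0 : 0 < T) (sy : is_step 0 T y) (sc : is_step 0 T c).

Let Sp := [set t | 0 <= t < T /\ c t < y t].
Let Sm := [set t | 0 <= t < T /\ y t < c t].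
Let W := maximal_intervals Sp.
Let B := maximal_intervals Sm.
Let w := lower_end W.
Let N a b := net_inflow y c a b.
Let D s := N s T.


Let Wl : lists_maximal_intervals Sp W /\
  forall t, Sp t -> exists2 I, I \in W & I t.
Proof.
by apply: maximal_intervalsP; exact: (is_step_comp (fun p => p.1 < p.2) (is_step_pair sc sy)).
Qed.

Let Bl : lists_maximal_intervals Sm B /\
  forall t, Sm t -> exists2 I, I \in B & I t.
Proof.
by apply: maximal_intervalsP; exact: (is_step_comp (fun p => p.1 < p.2) (is_step_pair sy sc)).
Qed.

Let lSp : has_lbound Sp. Proof. by exists 0 => t [/andP[]]. Qed.
Let uSm : has_ubound Sm. Proof. by exists T => t [/andP[_ /ltW]]. Qed.

Let nthW n : (n < size W)%N -> maximal_interval Sp (nth set0 W n).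
Proof. by move=> nW; apply/Wl.1.2; exact: mem_nth. Qed.

Let lt_w m n : (m < size W)%N -> (n < size W)%N -> (w m < w n) = (m < n)%N.
Proof.
move=> mW nW; have := Wl.1.1; rewrite -(@sorted_map _ _ (fun I : set R => inf I) <%O).
move=> /(lt_sorted_ltn_nth (inf set0)) /(_ m n).
by rewrite !inE size_map !(nth_map set0) // => ->.
Qed.

Let w_bound n : (n < size W)%N -> 0 <= w n < T.
Proof.
move=> nW; have mI := nthW nW.
have [_ [t [_ [_ It _]]] IS _] := mI.
have [/andP[t0 tT] _] := IS _ It.
rewrite (le_lt_trans (inf_le_maximal lSp mI It) tT) andbT.
apply: lb_le_inf; first by exists t.
by move=> u /IS[/andP[]].
Qed.

Let w_excess t : 0 <= t < T -> c t < y t ->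
  exists n, [/\ (n < size W)%N, w n <= t & forall u, w n < u <= t -> c u < y u].
Proof.
move=> tT ct; have [I IW It] := Wl.2 _ (conj tT ct).
exists (index I W); have nW : (index I W < size W)%N by rewrite index_mem.
have mI := nthW nW; have [iI _ IS _] := mI.
rewrite /w /lower_end !nth_index // in mI iI IS *; split=> //.
  exact: inf_le_maximal mI It.
by move=> u /andP[Iu ut]; have [] := IS _ (interval_gt_inf iI Iu ut It).
Qed.

Let w_right n : (n < size W)%N ->
  exists2 e, w n < e & forall t, w n < t <= e -> c t < y t.
Proof.
move=> nW; have [e we He] := maximal_interval_inf_lt lSp (nthW nW).
exists e => // t /He; have [_ _ IS _] := nthW nW; by move=> /IS[].
Qed.

Let D_cat a b : 0 <= a -> a <= b -> b <= T -> D a = N a b + D b.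
Proof. by move=> *; apply: (net_inflow_cat sy sc). Qed.

Let ge_of_no_excess a b : 0 <= a -> a <= b -> b <= T ->
  (forall t, a < t < b -> y t <= c t) -> D a <= D b.
Proof.
move=> a0 ab bT H; rewrite (D_cat a0 ab bT).
have := net_inflow_le0 sy sc a0 bT H; rewrite -/(N a b); lra.
Qed.

Let le_of_no_slack a b : 0 <= a -> a <= b -> b <= T ->
  (forall t, a < t < b -> c t <= y t) -> D b <= D a.
Proof.
move=> a0 ab bT H; rewrite (D_cat a0 ab bT).
have := net_inflow_ge0 sy sc a0 bT H; rewrite -/(N a b); lra.
Qed.

(** Between the end [b] of an interval of slack and the next start [w n] there
    is no excess, so a net outflow from [w r] to [b] persists until [w n]. *)
Let admissible_le r n : (r < n < size W)%N ->
  admissible_index y c W B r n -> D (w r) <= D (w n).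
Proof.
move=> /andP[rn nW] /hasP[I IB] /=; rewrite -/(w r) -/(w n) -/(w n.-1).
set b := sup I => /and3P[pb bn H].
have rW : (r < size W)%N by lia.
have pW : (n.-1 < size W)%N by lia.
have rp : w r <= w n.-1 by rewrite leNgt lt_w //; lia.
have /andP[wr0 _] := w_bound rW; have /andP[wn0 wnT] := w_bound nW.
have Nb : N (w r) b <= 0.
  rewrite subr_le0; move: H; case: ifP => // _; exact: ltW.
rewrite (@D_cat _ b) //; [|lra..].
suff : D b <= D (w n) by lra.
apply: ge_of_no_excess => //; [lra..|].
move=> t /andP[bt tn]; rewrite leNgt; apply/negP => ct.
have [|m [mW wmt Hm]] := w_excess _ ct; first lra.
have mn : (m <= n.-1)%N.
  have : w m < w n by exact: le_lt_trans tn.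
  by rewrite lt_w // -[in (m < n)%N](ltn_predK rn) ltnS.
have wmp : w m <= w n.-1 by rewrite leNgt lt_w // -leqNgt.
have mI : maximal_interval Sm I by apply/Bl.1.2.
have [_ [q [_ [_ Iq _]]] IS _] := mI.
have [p Ip wp] : exists2 p, I p & w m < p.
  by apply: sup_gt; [exists q|rewrite -/b; lra].
have pb' := le_sup_maximal uSm mI Ip.
have [_] := IS _ Ip; have := Hm p; rewrite -/b in pb'; lra.
Qed.

(** If [D] increases from [w n.-1] to [w n], there is slack in between.  Take
    the interval of slack that ends last, at [b] say: after [b] there is no
    slack, so [D] is at least as large at [b] as at [w n], hence larger than
    at [w r], and [b] witnesses admissibility in its strict form. *)
Let le_admissible r n : (r < n < size W)%N ->
  D (w r) < D (w n) -> D (w n.-1) <= D (w r) -> admissible_index y c W B r n.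
Proof.
move=> /andP[rn nW].
have rW : (r < size W)%N by lia.
have pW : (n.-1 < size W)%N by lia.
have rp : w r <= w n.-1 by rewrite leNgt lt_w //; lia.
have pn : w n.-1 < w n by rewrite lt_w //; lia.
have /andP[wr0 _] := w_bound rW; have /andP[wn0 wnT] := w_bound nW.
have slack t : w n.-1 < t < w n -> y t < c t ->
    exists2 I, I \in [seq I <- B | w n.-1 < sup I <= w n] & t <= sup I.
  move=> /andP[pt tn] yt; have [|I IB It] := Bl.2 t; first by split=> //; lra.
  have mI : maximal_interval Sm I by apply/Bl.1.2.
  have tI := le_sup_maximal uSm mI It.
  exists I => //; rewrite mem_filter IB andbT; apply/andP; split; first lra.
  rewrite leNgt; apply/negP => nI.
  have [iI _ IS _] := mI.
  have [p Ip np] : exists2 p, I p & w n < p by apply: sup_gt => //; exists t.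
  have [e ne He] := w_right nW.
  have Im : I (Num.min p e).
    by apply: (iI t p) => //; rewrite le_min ge_min lexx /= andbT; lra.
  have : c (Num.min p e) < y (Num.min p e).
    by apply: He; rewrite lt_min np ne ge_min lexx orbT.
  by have [_] := IS _ Im; lra.
move=> Drn Dpr; have [t0 t0n yt0] : exists2 t, w n.-1 < t < w n & y t < c t.
  apply: contrapT => no; move: Drn; rewrite ltNge => /negP; apply.
  have /andP[wp0 _] := w_bound pW.
  apply: le_trans Dpr; apply: (le_of_no_slack wp0 (ltW pn) (ltW wnT)).
  move=> t tn; rewrite leNgt; apply/negP => yt; apply: no; by exists t.
have ne : [seq I <- B | w n.-1 < sup I <= w n] != [::].
  by have [I IB _] := slack _ t0n yt0; apply: contraTneq IB => ->.
have [I] := exists_argmax sup ne; rewrite mem_filter => /andP[/andP[pI In] IB] Imax.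
apply/hasP; exists I => //=; rewrite -/(w r) -/(w n) -/(w n.-1) pI In /=.
set b := sup I in pI In Imax *.
suff : N (w r) b < 0.
  by rewrite /N subr_lt0 => Nb; case: ifP => // _; exact: ltW.
have rb : w r < b := le_lt_trans rp pI.
have b0 : 0 <= b := le_trans wr0 (ltW rb).
have DbE := D_cat wr0 (ltW rb) (le_trans In (ltW wnT)).
have Db : D (w n) <= D b.
  apply: (le_of_no_slack b0 In (ltW wnT)).
  move=> t /andP[bt tn]; rewrite leNgt; apply/negP => yt.
  have [|J JB tJ] := slack t _ yt; first by rewrite tn (lt_trans pI bt).
  by move: (lt_le_trans bt tJ); rewrite ltNge Imax.
have := lt_le_trans Drn Db; by rewrite DbE gtrDr.
Qed.

(** From [s], move to the first interval of excess that reaches beyond [s]: it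
    started before [s] and [D] has decreased since, or it starts later and [D]
    increases until then.  Without any such interval [D] increases up to
    [D T = 0]. *)
Let D_le_w s : 0 <= s <= T ->
  D s <= 0 \/ exists2 n, (n < size W)%N & D s <= D (w n).
Proof.
move=> /andP[s0 sT].
have DT : D T = 0.
  by have := D_cat (ltW T0) (lexx T) (lexx T); rewrite /D; lra.
pose P n := (n < size W)%N && `[< exists2 t, s <= t < T &
  w n <= t /\ forall u, w n < u <= t -> c u < y u >].
have [exP|noP] := pselect (exists n, P n); last first.
  left; rewrite -DT; apply: ge_of_no_excess => //.
  move=> t /andP[st tT]; rewrite leNgt; apply/negP => ct; apply: noP.
  have [|n [nW wt Hn]] := w_excess _ ct; first lra.
  by exists n; rewrite /P nW /=; apply/asboolP; exists t => //; rewrite tT ltW.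
right; case: (ex_minnP exP) => n /andP[nW /asboolP[t /andP[st tT] [wt Hn]]] nmin.
exists n => //; have /andP[w0 wT] := w_bound nW.
have [ws|sw] := leP (w n) s.
  by apply: le_of_no_slack => // u /andP[wu us]; apply/ltW/Hn; lra.
apply: ge_of_no_excess => //; [lra..|].
move=> u /andP[su uw]; rewrite leNgt; apply/negP => cu.
have [|m [mW wu Hm]] := w_excess _ cu; first lra.
have : (n <= m)%N.
  by apply: nmin; rewrite /P mW; apply/asboolP; exists u => //; lra.
by rewrite leqNgt -lt_w //; lra.
Qed.

(** Jointly, the two parts say that the initial queue is the maximum over [s] of
    the net inflow from [s] to [T]: it is attained, the value 0 being reached at
    [s = T].  It is also the level at time [T] of a queue that is empty at 0. *)
Lemma initial_queue_max :
  (exists2 a, 0 <= a <= T &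
    initial_queue T y c = Num.max (net_inflow y c a T) 0) /\
  forall s, 0 <= s <= T -> net_inflow y c s T <= initial_queue T y c.
Proof.
set m := last_index y c W B.
have qE : initial_queue T y c = Num.max (D (w m)) 0 by [].
have [W0|W0] := posnP (size W).
  split; last first.
    move=> s /D_le_w[Ds|[n]]; last by rewrite W0.
    by rewrite qE le_max Ds orbT.
  exists (w m) => //; rewrite /w /lower_end nth_default ?W0 // inf0 lexx ltW //.
have [mW Hm] : (m < size W)%N /\ forall n, (n < size W)%N -> D (w n) <= D (w m).
  exact: (@greedy_max _ _ (fun n => D (w n)) (admissible_index y c W B) _
    W0 admissible_le le_admissible).
split; first by exists (w m) => //; have := w_bound mW; lra.
move=> s /D_le_w[Ds|[n /Hm Dn Ds]]; rewrite qE le_max.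
  by rewrite Ds orbT.
by rewrite (le_trans Ds Dn).
Qed.

End InitialQueue.

Lemma initial_queue_ge0 (R : realType) (T : R) (y c : R -> R) :
  0 <= initial_queue T y c.
Proof. by rewrite /initial_queue /= le_max lexx orbT. Qed.

Lemma initial_queue_le (R : realType) (T : R) (y y' c : R -> R) : 0 < T ->
  is_step 0 T y -> is_step 0 T y' -> is_step 0 T c ->
  (forall t, 0 <= t < T -> y t <= y' t) ->
  initial_queue T y c <= initial_queue T y' c.
Proof.
move=> T0 sy sy' sc yy'.
have [[a aT ->] _] := initial_queue_max T0 sy sc.
have [_ /(_ _ aT)] := initial_queue_max T0 sy' sc.
rewrite ge_max initial_queue_ge0 andbT; apply: le_trans; rewrite lerD2r; apply: (@le_integral_on _ T) => //; [lra|].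
by move=> t tT; apply: yy'; lra.
Qed.

(** * Isolated-link dynamics *)

Section Dynamics.
Context {R : realType}.
Implicit Types (a b d t T : R) (x y c f : R -> R).

(** The mean value theorem applies on each side of an exceptional instant, and
    continuity at that instant joins the two estimates. *)
Lemma nonincreasing_off_seq (s : seq R) f (df : R -> R) a b : a <= b ->
  {within `[a, b], continuous f} ->
  (forall t, a < t < b -> t \notin s ->
    is_derive t (1 : R) f (df t) /\ df t <= 0) ->
  f b <= f a.
Proof.
elim: s a b => [|p s IH] a b ab cf H.
  have D t : t \in `]a, b[ -> is_derive t (1 : R) f (df t).
    by rewrite in_itv /= => tab; have [] := H t tab isT.
  move: ab; rewrite le_eqVlt => /predU1P[->//|ab].
  have [t] := MVT ab D cf.
  rewrite in_itv /= => tab E; have [_ dt0] := H t tab isT.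
  rewrite -subr_le0 E mulr_le0_ge0 // subr_ge0 ltW //.
have [/andP[ap pb]|out] := boolP (a < p < b); last first.
  apply: IH => // t tab ts; apply: H => //; rewrite inE negb_or ts andbT.
  by apply: contraNneq out => <-.
have sub u v : a <= u -> v <= b -> {within `[u, v], continuous f}.
  move=> au vb; apply: continuous_subspaceW cf => t /=; rewrite !in_itv /= => uv.
  lra.
have fbp : f b <= f p.
  apply: IH (ltW pb) (sub _ _ (ltW ap) (lexx b)) _ => t tpb ts.
  apply: H; first lra.
  by rewrite inE negb_or ts andbT; apply: contraTneq tpb => ->; rewrite ltxx.
apply: le_trans fbp _.
apply: IH (ltW ap) (sub _ _ (lexx a) (ltW pb)) _ => t tap ts.
apply: H; first lra.
by rewrite inE negb_or ts andbT; apply: contraTneq tap => ->; rewrite ltxx andbF.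
Qed.

Lemma nonincreasing_off_finite (A : set R) f (df : R -> R) a b :
  finite_set A -> a <= b -> {within `[a, b], continuous f} ->
  (forall t, a < t < b -> ~ A t ->
    is_derive t (1 : R) f (df t) /\ df t <= 0) ->
  f b <= f a.
Proof.
move=> /finite_seqP[s ->] ab cf H; apply: (nonincreasing_off_seq (s := s) ab cf).
by move=> t tab ts; apply: H => //=; exact/negP.
Qed.

(** The dynamics of [isolated_link_solution] on an arbitrary interval, so that
    solutions can be cut and glued. *)
Definition solution_on a b y c x : Prop :=
  [/\ forall t, a <= t <= b -> 0 <= x t, {within `[a, b], continuous x}
    & exists2 A : set R, finite_set A & forall t, a < t < b -> ~ A t ->
        is_derive t (1 : R) x (y t - link_outflow x y c t)].

Lemma isolated_link_solutionE T y c (x0 : R) x :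
  isolated_link_solution T y c x0 x <-> x 0 = x0 /\ solution_on 0 T y c x.
Proof. by split=> [[? ? ? ?]|[? [? ? ?]]]; split. Qed.

(** [s] is the supremum of the points where [f <= 0], at which [f <= 0] still
    holds by continuity. *)
Lemma last_crossing f a b : a <= b -> {within `[a, b], continuous f} ->
  f a <= 0 -> 0 < f b ->
  exists2 s, a <= s < b & f s <= 0 /\ forall t, s < t <= b -> 0 < f t.
Proof.
move=> ab cf fa fb.
pose Z := [set t | a <= t <= b /\ f t <= 0].
have Za : Z a by rewrite /Z /= lexx ab.
have uZ : ubound Z b by move=> t [/andP[]].
have hZ : has_sup Z by split; [exists a|exists b].
have as_ : a <= sup Z by apply: ub_le_sup Za; exists b.
have sb : sup Z <= b by apply: ge_sup => //; exists a.
have fs : f (sup Z) <= 0.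
  rewrite leNgt; apply/negP => fs.
  have /(_ (sup Z)) := (subspace_continuousP _ _).1 cf.
  rewrite /= in_itv /= as_ sb => /(_ isT) /cvgr_gt -/(_ _ fs).
  rewrite near_withinE => /nbhs_ballP[e /= e0 He].
  have [u [/andP[au ub] fu] us] := sup_adherent e0 hZ.
  have us' : u <= sup Z by apply: ub_le_sup; [exists b|split=> //; rewrite au].
  have : ball (sup Z) e u.
    by rewrite /ball /= ger0_norm ?subr_ge0 // ltrBlDl -ltrBlDr.
  by move=> /He; rewrite in_itv /= au ub => /(_ isT); rewrite ltNge fu.
exists (sup Z).
  rewrite as_ lt_neqAle sb andbT; apply: contraTneq fb => <-; by rewrite -leNgt.
split=> // t /andP[st tb]; rewrite ltNge; apply/negP => ft.
have : t <= sup Z by apply: ub_le_sup; [exists b|split=> //; rewrite tb andbT; lra].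
by rewrite leNgt st.
Qed.

(** Suppose that [x1] exceeds [x2] at [t], and let [s] be the last instant
    before [t] at which it does not.  On the way from [s] to [t] the first
    queue is positive, so it is served at the rate [c], and [x1 - x2] has
    derivative at most [y1 - y2 <= 0]. *)
Lemma solution_le a b y1 y2 c x1 x2 :
  (forall t, a < t < b -> y1 t <= y2 t) ->
  solution_on a b y1 c x1 -> solution_on a b y2 c x2 -> x1 a <= x2 a ->
  forall t, a <= t <= b -> x1 t <= x2 t.
Proof.
move=> y12 [_ cx1 [A1 fA1 D1]] [x2_ge0 cx2 [A2 fA2 D2]] x12 t /andP[at_ tb].
rewrite leNgt; apply/negP => x21.
pose f := x1 \- x2.
have cf s : a <= s -> {within `[s, t], continuous f}.
  move=> as_.
  have st_ab : `[s, t] `<=` `[a, b].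
    by move=> u /=; rewrite !in_itv /=; lra.
  move=> u; apply: cvgB.
    exact: (continuous_subspaceW st_ab cx1).
  exact: (continuous_subspaceW st_ab cx2).
have [s /andP[as_ st] [fs Hs]] : exists2 s, a <= s < t &
    f s <= 0 /\ forall u, s < u <= t -> 0 < f u.
  by apply: last_crossing => //; [exact: cf|rewrite subr_le0|rewrite subr_gt0].
have : f t <= f s.
  apply: (@nonincreasing_off_finite (A1 `|` A2) _
    (fun u => (y1 u - link_outflow x1 y1 c u) - (y2 u - link_outflow x2 y2 c u))).
  - by rewrite finite_setU.
  - exact: ltW.
  - exact: cf.
  move=> u /andP[su ut] /not_orP[nA1 nA2].
  have uab : a < u < b by lra.
  split; first by apply: is_deriveB; [exact: D1|exact: D2].
  have fu : 0 < f u by apply: Hs; rewrite su ltW.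
  have x2u : 0 <= x2 u by apply: x2_ge0; lra.
  have x1u : 0 < x1 u by move: fu; rewrite subr_gt0; lra.
  have z2 : link_outflow x2 y2 c u <= c u.
    by rewrite /link_outflow; case: ifP => // _; rewrite ge_min lexx.
  have -> : link_outflow x1 y1 c u = c u by rewrite /link_outflow x1u.
  have := y12 _ uab; lra.
have : 0 < f t by rewrite subr_gt0.
lra.
Qed.

(** A solution leading from level [x0] at [a] to level [x1] at [b].  The
    outflow is tracked too, because a step outflow is what allows the next
    iteration. *)
Definition flow y c a b (x0 x1 : R) : Prop :=
  exists x, [/\ x a = x0, x b = x1, solution_on a b y c x
               & is_step a b (link_outflow x y c)].

Lemma flow_cat y c a d b (x0 xd xb : R) : a < d -> d < b ->
  flow y c a d x0 xd -> flow y c d b xd xb -> flow y c a b x0 xb.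
Proof.
move=> ad db [x1 [x1a x1d [x1_ge0 cx1 [A1 fA1 D1]] [E1 sz1]]].
move=> [x2 [x2d x2b [x2_ge0 cx2 [A2 fA2 D2]] [E2 sz2]]].
pose x t := if t <= d then x1 t else x2 t.
have xl t : t <= d -> x t = x1 t by rewrite /x => ->.
have xr t : d <= t -> x t = x2 t.
  rewrite le_eqVlt => /predU1P[<-|dt]; first by rewrite xl // x2d x1d.
  by rewrite /x leNgt dt.
have zl t : t <= d -> link_outflow x y c t = link_outflow x1 y c t.
  by move=> td; rewrite /link_outflow xl.
have zr t : d <= t -> link_outflow x y c t = link_outflow x2 y c t.
  by move=> td; rewrite /link_outflow xr.
exists x; split; [by rewrite xl ?ltW|by rewrite xr ?ltW|split|].
  - move=> t /andP[at_ tb]; have [td|dt] := leP t d.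
      by rewrite xl // x1_ge0 // at_.
    by rewrite (xr _ (ltW dt)) x2_ge0 // tb ltW.
  - have -> : `[a, b]%classic = `[a, d]%classic `|` `[d, b]%classic.
      apply/seteqP; split=> t /=; rewrite !in_itv /=; last by case; lra.
      by move=> ?; have [?|?] := leP t d; [left|right]; lra.
    apply: withinU_continuous; [exact: itv_closed|exact: itv_closed| |].
      apply: (subspace_eq_continuous _ cx1) => t; rewrite inE /= in_itv /=.
      by move=> /andP[_ td]; exact/esym/xl.
    apply: (subspace_eq_continuous _ cx2) => t; rewrite inE /= in_itv /=.
    by move=> /andP[td _]; exact/esym/xr.
  exists (A1 `|` A2 `|` [set d]); first by rewrite !finite_setU.
  move=> t /andP[at_ tb] /not_orP[/not_orP[nA1 nA2] /eqP td].
  have [{}td|dt|/eqP] := ltgtP t d; last by rewrite (negbTE td).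
    rewrite (zl _ (ltW td)); apply: near_eq_is_derive (D1 t _ nA1); last by rewrite at_.
    by near=> u; rewrite xl // ltW //; near: u; exact: lt_nbhsl.
  rewrite (zr _ (ltW dt)); apply: near_eq_is_derive (D2 t _ nA2); last by rewrite dt.
  by near=> u; rewrite xr // ltW //; near: u; exact: lt_nbhsr.
exists (d :: E1 ++ E2) => t u at_ tu ub H.
have H1 e : e \in E1 -> ~~ (t < e <= u).
  by move=> eE; apply: H; rewrite inE mem_cat eE orbT.
have H2 e : e \in E2 -> ~~ (t < e <= u).
  by move=> eE; apply: H; rewrite inE mem_cat eE !orbT.
have [ud|du] := ltP u d.
  by rewrite (zl _ (ltW ud)) (zl _ (le_trans tu (ltW ud))); apply: sz1.
have [dt|td] := leP d t; first by rewrite (zr _ dt) (zr _ (le_trans dt tu)); apply: sz2.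
by have := H d; rewrite inE eqxx td du => /(_ isT).
Unshelve. all: by end_near. Qed.

Section ConstantPiece.
Variables (y c : R -> R) (a b : R).
Hypotheses (ab : a < b) (yc : forall t, a <= t < b -> (y t, c t) = (y a, c a)).
Let h := y a - c a.

Let yE t : a <= t < b -> y t = y a. Proof. by move=> /yc[]. Qed.
Let cE t : a <= t < b -> c t = c a. Proof. by move=> /yc[]. Qed.

(** The outflow is [c] also at an instant where the affine queue vanishes,
    provided that the inflow is then at least [c]. *)
Lemma affine_solution (x0 : R) :
  (forall t, a <= t <= b -> 0 <= x0 + h * (t - a)) ->
  (forall t, a <= t < b -> 0 < x0 + h * (t - a) \/ c a <= y a) ->
  flow y c a b x0 (x0 + h * (b - a)).
Proof.
move=> x_ge0 busy; pose x t := x0 + h * (t - a).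
have zE t : a <= t < b -> link_outflow x y c t = c a.
  move=> tab; rewrite /link_outflow cE // yE //; case: ifPn => // xt.
  by have [|/min_idPl //] := busy t tab; rewrite -/(x t) (negbTE xt).
exists x; split.
- by rewrite /x subrr mulr0 addr0.
- by [].
- split=> //.
    apply: continuous_subspaceT => t; apply: cvgD; first exact: cvg_cst.
    by apply: cvgM; [exact: cvg_cst|apply: cvgB; [exact: cvg_id|exact: cvg_cst]].
  exists set0 => // t tab _; rewrite zE ?yE; [|lra..].
  by rewrite /x; apply: is_derive_eq; rewrite add0r mul1r subr0 /GRing.scale /= mulr1.
by apply: is_step_eq (is_step_cst a b (c a)) => t /zE ->.
Qed.

Lemma empty_solution : y a <= c a -> flow y c a b 0 0.
Proof.
move=> yac.
have zE t : a <= t < b -> link_outflow (cst 0) y c t = y a.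
  by move=> tab; rewrite /link_outflow ltxx cE // yE //; apply/min_idPr.
exists (cst 0); split=> //; last first.
  by apply: is_step_eq (is_step_cst a b (y a)) => t /zE ->.
split=> //; first by apply: continuous_subspaceT => t; exact: cvg_cst.
exists set0 => // t tab _; rewrite zE ?yE; [|lra..].
by rewrite subrr; exact: is_derive_cst.
Qed.

End ConstantPiece.

Definition solvable y c a b : Prop := forall x0 : R, 0 <= x0 ->
  exists2 xb, 0 <= xb & flow y c a b x0 xb.

Lemma solvable_cat y c a d b : a < d -> d < b ->
  solvable y c a d -> solvable y c d b -> solvable y c a b.
Proof.
move=> ad db S1 S2 x0 /S1[xd /S2[xb xb0 F2] F1].
by exists xb => //; exact: flow_cat F1 F2.
Qed.

(** With excess the queue grows at the rate [y - c].  With slack it decreases at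
    that rate until the instant [tau] at which it would empty, and is empty
    from then on. *)
Lemma solvable_cst y c a b : a < b ->
  (forall t, a <= t < b -> (y t, c t) = (y a, c a)) -> solvable y c a b.
Proof.
move=> ab yc x0 x0_ge0; have [cy|cy] := leP (c a) (y a).
  have x_ge0 t : a <= t <= b -> 0 <= x0 + (y a - c a) * (t - a).
    by move=> ?; rewrite addr_ge0 // mulr_ge0 //; lra.
  exists (x0 + (y a - c a) * (b - a)); first by apply: x_ge0; lra.
  by apply: affine_solution => // t _; right.
pose tau := a + x0 / (c a - y a).
have xE t : x0 + (y a - c a) * (t - a) = (c a - y a) * (tau - t).
  by rewrite /tau; field; lra.
have tau_ge : a <= tau by rewrite lerDl divr_ge0 //; lra.
have affine e : a < e -> e <= b -> e <= tau ->
    flow y c a e x0 ((c a - y a) * (tau - e)).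
  move=> ae eb etau; rewrite -xE; apply: affine_solution => // t tae.
  - by apply: yc; lra.
  - by rewrite xE mulr_ge0 //; lra.
  - by left; rewrite xE mulr_gt0 //; lra.
have [btau|taub] := leP b tau.
  by exists ((c a - y a) * (tau - b)); [rewrite mulr_ge0 //; lra|exact: affine].
have empty : flow y c tau b 0 0.
  have E t : tau <= t < b -> (y t, c t) = (y a, c a) by move=> ?; apply: yc; lra.
  apply: empty_solution => //.
    by move=> t tb; rewrite E // E //; lra.
  by have := E tau; rewrite lexx taub => /(_ isT) [-> ->]; exact: ltW.
exists 0 => //; have [tau_gt|] := ltP a tau.
  apply: flow_cat empty => //.
  by have := affine tau tau_gt (ltW taub) (lexx tau); rewrite subrr mulr0.
move=> tau_le; have tauE : tau = a by lra.
suff -> : x0 = 0 by rewrite -tauE.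
by have := xE a; rewrite tauE !subrr !mulr0 addr0.
Qed.

Lemma solvable_step y c a b : a < b -> is_step a b y -> is_step a b c ->
  solvable y c a b.
Proof.
move=> ab sy sc; apply: (step_ind (f := fun t => (y t, c t)) _ _ ab).
- exact: solvable_cst.
- exact: solvable_cat.
- exact: is_step_pair.
Qed.

End Dynamics.

(** * Monotonicity of a single link *)

Section SingleLinkMonotone.
Context {R : realType}.
Implicit Types (a b d t T : R) (x y c g : R -> R).
Notation mu := (@lebesgue_measure R).

Lemma step_set_measurable a b (p : R -> bool) : a < b -> is_step a b p ->
  measurable [set t | a <= t < b /\ p t].
Proof.
apply: (step_ind (P := fun a b => measurable [set t | a <= t < b /\ p t])) => {a b}.
  move=> a b ab pE; have [pa|pa] := boolP (p a).
    rewrite (_ : [set _ | _] = `[a, b[%classic); first exact: measurable_itv.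
    apply/seteqP; split=> t /=; rewrite in_itv /=; first by case.
    by move=> tab; rewrite pE.
  rewrite (_ : [set _ | _] = set0) //; apply/seteqP; split=> // t [tab].
  by rewrite pE // (negbTE pa).
move=> a d b ad db m1 m2.
rewrite (_ : [set _ | _] =
  [set t | a <= t < d /\ p t] `|` [set t | d <= t < b /\ p t]); first exact: measurableU.
apply/seteqP; split=> t /=; last by move=> [[? ?]|[? ?]]; split=> //; lra.
by move=> [tab pt]; have [?|?] := ltP t d; [left|right]; split=> //; lra.
Qed.

(** A set described by a step function contains, with each of its points, a
    right neighbourhood of it, so it is null only when it is empty. *)
Lemma null_step_set T (p : R -> bool) : 0 < T -> is_step 0 T p ->
  mu [set t | 0 <= t < T /\ p t] = 0%E -> forall t, 0 <= t < T -> ~~ p t.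
Proof.
move=> T0 sp mu0 t /andP[t0 tT]; apply/negP => pt.
have [D sD] := sp; have [e /andP[te eT] He] := exists_next D tT.
have sub : `[t, e[%classic `<=` [set t | 0 <= t < T /\ p t].
  move=> u /=; rewrite in_itv /= => /andP[tu ue]; split; first lra.
  rewrite -(sD t u) //; first lra.
  move=> d /He; apply: contra => /andP[-> du] /=; exact: le_lt_trans du ue.
have : (mu `[t, e[%classic <= 0)%E.
  rewrite -mu0; apply: le_measure => //; apply/mem_set; first exact: measurable_itv.
  exact: step_set_measurable.
by rewrite lebesgue_measure_itv /= lte_fin te -EFinB lee_fin; lra.
Qed.

(** The two cases of the procedure, with the test on the measure replaced by the
    existence of a single instant of excess. *)
Lemma queue_on_periodP T y c : 0 < T -> is_step 0 T y -> is_step 0 T c ->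
  ((forall t, 0 <= t < T -> y t <= c t) /\ queue_on_period T y c = cst 0) \/
  ((exists2 t, 0 <= t < T & c t < y t) /\
   isolated_link_solution T y c (initial_queue T y c) (queue_on_period T y c)).
Proof.
move=> T0 sy sc; rewrite /queue_on_period; case: eqP => [mu0|mu_neq0].
  left; split=> // t tT; rewrite leNgt.
  have sp := is_step_comp (fun p => p.1 < p.2) (is_step_pair sc sy).
  exact: (null_step_set T0 sp mu0).
right; split.
  apply: contrapT => no; apply: mu_neq0; rewrite (_ : [set _ | _] = set0) ?measure0 //.
  by apply/seteqP; split=> // t [tT ct]; apply: no; exists t.
apply: xgetPex; have [xb _ [x [x0E _ sol _]]] :=
  solvable_step T0 sy sc (initial_queue_ge0 T y c).
by exists x; apply/isolated_link_solutionE.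
Qed.

Lemma queue_on_period_ge0 T y c t : 0 < T -> is_step 0 T y -> is_step 0 T c ->
  0 <= t <= T -> 0 <= queue_on_period T y c t.
Proof.
by move=> T0 sy sc tT; have [[_ ->//]|[_ [_ + _ _]]] := queue_on_periodP T0 sy sc; apply.
Qed.

Lemma queue_on_period_le T y y' c t : 0 < T ->
  is_step 0 T y -> is_step 0 T y' -> is_step 0 T c ->
  (forall u, 0 <= u < T -> y u <= y' u) -> 0 <= t <= T ->
  queue_on_period T y c t <= queue_on_period T y' c t.
Proof.
move=> T0 sy sy' sc yy' tT.
have [[_ ->]|[[u uT cu] sol]] := queue_on_periodP T0 sy sc.
  exact: queue_on_period_ge0.
have [[yc _]|[_ sol']] := queue_on_periodP T0 sy' sc.
  by exfalso; move: cu; rewrite ltNge (le_trans (yy' _ uT) (yc _ uT)).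
have /isolated_link_solutionE[x0 sol0] := sol.
have /isolated_link_solutionE[x0' sol0'] := sol'.
apply: solution_le sol0 sol0' _ _ tT.
  by move=> v /andP[/ltW v0 vT]; apply: yy'; rewrite v0.
by rewrite x0 x0'; exact: initial_queue_le.
Qed.

(** By uniqueness, the solution selected by the procedure is the one built piece
    by piece, whose outflow is a step function. *)
Lemma outflow_on_period_step T y c : 0 < T -> is_step 0 T y -> is_step 0 T c ->
  is_step 0 T (link_outflow (queue_on_period T y c) y c).
Proof.
move=> T0 sy sc; have [[_ ->]|[_ sol]] := queue_on_periodP T0 sy sc.
  have := is_step_comp (fun p => Num.min p.1 p.2) (is_step_pair sc sy).
  by apply: is_step_eq => t _; rewrite /link_outflow ltxx.
have /isolated_link_solutionE[x0 sol0] := sol.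
have [xb _ [x [x0E _ sol' sz]]] := solvable_step T0 sy sc (initial_queue_ge0 T y c).
apply: is_step_eq sz => t tT; rewrite /link_outflow.
suff -> : x t = queue_on_period T y c t by [].
have tT' : 0 <= t <= T by lra.
apply/le_anti/andP; split.
  by apply: solution_le sol' sol0 _ _ tT' => //; rewrite x0 x0E.
by apply: solution_le sol0 sol' _ _ tT' => //; rewrite x0 x0E.
Qed.

(** A link that is busy with the smaller queue is busy with the larger one; an
    idle link lets through at most [c], and its flow increases with [y]. *)
Lemma link_outflow_le x x' y y' c t : x t <= x' t -> y t <= y' t ->
  link_outflow x y c t <= link_outflow x' y' c t.
Proof.
move=> xx' yy'; rewrite /link_outflow; case: ifPn => xt; case: ifPn => xt' //.
- by rewrite (lt_le_trans xt xx') in xt'.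
- by rewrite ge_min lexx.
- by rewrite le_min !ge_min lexx yy' orbT.
Qed.

Lemma period_representative T t : 0 < T ->
  0 <= t - (Num.floor (t / T))%:~R * T < T.
Proof.
move=> T0; have /andP[] := floor_itv (t / T).
rewrite ler_pdivlMr // ltr_pdivrMr // intrD mulrDl mul1r; lra.
Qed.

Lemma Fx_le T y y' c t : 0 < T ->
  is_step 0 T y -> is_step 0 T y' -> is_step 0 T c ->
  (forall u, 0 <= u < T -> y u <= y' u) -> Fx T y c t <= Fx T y' c t.
Proof.
move=> T0 sy sy' sc yy'; apply: queue_on_period_le => //.
by have := period_representative t T0; lra.
Qed.

Lemma Fz_le T y y' c t : 0 < T ->
  is_step 0 T y -> is_step 0 T y' -> is_step 0 T c ->
  (forall u, 0 <= u < T -> y u <= y' u) -> Fz T y c t <= Fz T y' c t.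
Proof.
move=> T0 sy sy' sc yy'; have tT := period_representative t T0.
by apply: link_outflow_le; [apply: queue_on_period_le => //; lra|exact: yy'].
Qed.

Lemma Fz_ge0 T y c t : (forall u, 0 <= y u) -> (forall u, 0 <= c u) ->
  0 <= Fz T y c t.
Proof.
move=> y0 c0; rewrite /Fz /periodic_extension /link_outflow.
by case: ifP => // _; rewrite le_min y0 c0.
Qed.

(** A window of one period delayed by [d] meets two periods, the ones with
    numbers [k] and [k + 1].  The breaks of [g] are repeated in both, and the
    boundary [p (k + 1)] between them is one more break. *)
Lemma periodic_extension_delay_step T d g : 0 < T -> is_step 0 T g ->
  is_step 0 T (fun t => periodic_extension T g (t - d)).
Proof.
move=> T0 [D sg].
pose k := Num.floor (- d / T).
pose p (j : int) := d + j%:~R * T.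
exists (p (k + 1) :: [seq e + p k | e <- D] ++ [seq e + p (k + 1) | e <- D]).
move=> t u t0 tu uT H.
have same (j : int) : p j <= t -> u < p (j + 1) ->
    {in D, forall e, ~~ (t < e + p j <= u)} ->
    periodic_extension T g (t - d) = periodic_extension T g (u - d).
  rewrite /p intrD mulrDl mul1r => jt uj Hj.
  have floorE v : t <= v <= u -> Num.floor ((v - d) / T) = j.
    move=> /andP[tv vu]; apply: floor_def.
    by rewrite ler_pdivlMr // ltr_pdivrMr // intrD mulrDl mul1r; lra.
  rewrite /periodic_extension !floorE ?lexx ?tu //; apply: sg; [lra..|].
  move=> e /Hj; apply: contra; lra.
have /andP[kd dk] := floor_itv (- d / T).
rewrite -/k ler_pdivlMr // in kd; rewrite -/k ltr_pdivrMr // in dk.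
have pS (j : int) : p (j + 1) = p j + T by rewrite /p intrD mulrDl mul1r addrA.
have [up|pu] := ltP u (p (k + 1)).
  apply: (same k) => //; first by rewrite /p; lra.
  move=> e eD; apply: H; rewrite inE mem_cat; apply/orP; right; apply/orP; left.
  exact: map_f.
have [tp|pt] := ltP t (p (k + 1)).
  by have := H (p (k + 1)); rewrite inE eqxx tp pu => /(_ isT).
apply: (same (k + 1)) => //.
  by rewrite pS /p; lra.
move=> e eD; apply: H; rewrite inE mem_cat; apply/orP; right; apply/orP; right.
exact: (map_f (fun e => e + p (k + 1))).
Qed.

End SingleLinkMonotone.

(** * The network iteration *)

Theorem proposition5 (R : realType) (V E : finType) (tail head : E -> V)
    (Rt delta : E -> E -> R) (T : R) (lam c : E -> R -> R)
    (no_loop : forall e, tail e != head e)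
    (Rt_routing : routing_matrix tail head Rt)
    (connected : connectivity tail head Rt)
    (delta_ge0 : forall j i, 0 <= delta j i)
    (T_gt0 : 0 < T)
    (lam_signal : forall i, signal T (lam i))
    (c_signal : forall i, signal T (c i))
    (stable : stability T Rt lam c) :
  forall k : nat, (1 <= k)%N -> forall (i : E) (t : R), 0 <= t <= T ->
    outflow T Rt delta lam c k i t <= outflow T Rt delta lam c k.+1 i t /\
    queue T Rt delta lam c k i t <= queue T Rt delta lam c k.+1 i t.
Proof.
have Rt_ge0 j i : 0 <= Rt j i by case: Rt_routing => -[].
have lam_ge0 i t : 0 <= lam i t by case: (lam_signal i).
have c_ge0 i t : 0 <= c i t by case: (c_signal i).
have lam_step i : is_step 0 T (lam i).
  by apply: piecewise_constant_step; case: (lam_signal i).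
have c_step i : is_step 0 T (c i).
  by apply: piecewise_constant_step; case: (c_signal i).
pose y n := iter n (next_inflow T Rt delta lam c) lam.
have y_step n i : is_step 0 T (y n i).
  elim: n i => [|n IH] i //=.
  have := is_step_comp (fun p => p.1 + p.2) (is_step_pair (lam_step i)
    (@is_step_sum _ E 0 T (fun j t => Rt j i * Fz T (y n j) (c j) (t - delta j i)) _)).
  apply=> j; apply: (is_step_comp (fun z => Rt j i * z)).
  by apply: periodic_extension_delay_step => //; exact: outflow_on_period_step.
have y_ge0 n i t : 0 <= y n i t.
  elim: n i t => [|n IH] i t //=; rewrite addr_ge0 // sumr_ge0 // => j _.
  by rewrite mulr_ge0 // Fz_ge0.
have y_le n i t : y n i t <= y n.+1 i t.
  elim: n i t => [|n IH] i t.
    by rewrite lerDl sumr_ge0 // => j _; rewrite mulr_ge0 // Fz_ge0.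
  rewrite lerD2l ler_sum // => j _; rewrite ler_wpM2l //.
  by apply: Fz_le => //; exact: (y_step n.+1).
move=> [//|n] _ i t _; split.
  exact: (Fz_le t T_gt0 (y_step n i) (y_step n.+1 i) (c_step i) (fun u _ => y_le n i u)).
exact: (Fx_le t T_gt0 (y_step n i) (y_step n.+1 i) (c_step i) (fun u _ => y_le n i u)).
Qed.
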